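(* Let $G$ be a finite group and $p$ a prime such that the Sylow $p$-subgroups of $G$ are cyclic. Let $H_1,\dots,H_m$ be representatives of the conjugacy classes of non-cyclic $p$-hypo-elementary subgroups of $G$. Then the $m\times m$ rational matrix $T$ with entries $$T_{ab}=v_p\big(C_{\theta_{H_a}}(\mathbb{Z}_p[G/H_b])\big)$$ is invertible. Equivalently, the permutation pairing $\langle\ ,\ \rangle_{\mathrm{perm}}$ on $P(G)$ is non-degenerate.
   Context: Throughout, $G$ is a finite group and $p$ a prime. A finite group is $p$-hypo-elementary if it has a normal Sylow $p$-subgroup $P$ such that the quotient by $P$ is cyclic. Burnside ring: $b(G)$ is the free abelian group on the symbols $[H]$, where $H$ runs over conjugacy classes of subgroups of $G$; here $[H]$ stands for the $G$-set $G/H$. Set $B(G)=b(G)\otimes\mathbb{Q}$. For a subgroup $H\le G$, elements of $B(H)$ are regarded as elements of $B(G)$ via induction $[K]\mapsto[K]$. Lattices and relations: for a commutative ring $R$, an $R[G]$-lattice is an $R[G]$-module that is free of finite rank over $R$. $A(R[G])$ is the Grothendieck group of $R[G]$-lattices with respect to direct sums, tensored with $\mathbb{Q}$. Let $b_R\colon B(G)\to A(R[G])$ be the linear map $[H]\mapsto[R[G/H]]$. Set $\mathrm{BR}_0(G)=\ker b_{\mathbb{Q}}$ (rational Brauer relations); integral ones are those lying in $b(G)$. Regulator constants: let $\mathcal R\in\{\mathbb{Z},\mathbb{Z}_{(p)},\mathbb{Z}_p\}$ have fraction field $\mathcal K$. An $\mathcal R[G]$-lattice $M$ is rationally self-dual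 if $M\otimes\mathcal K$ is isomorphic to its $\mathcal K$-linear dual as a $\mathcal K[G]$-module; equivalently, there is a non-degenerate $G$-invariant symmetric bilinear form $\langle\ ,\ \rangle\colon M\times M\to\mathcal K$. For an integral relation $\theta=\sum_i[H_i]-\sum_j[H'_j]$ one defines $$C_\theta(M)=\frac{\prod_i\det\big(\tfrac{1}{|H_i|}\langle\ ,\ \rangle|_{M^{H_i}}\big)}{\prod_j\det\big(\tfrac{1}{|H'_j|}\langle\ ,\ \rangle|_{M^{H'_j}}\big)}\in\mathcal K^\times/(\mathcal R^\times)^2.$$ Each determinant is the Gram determinant with respect to an $\mathcal R$-basis of the fixed sublattice; the value is independent of the chosen form. Let $v_p$ be the $p$-adic valuation, which is well defined on $\mathbb{Q}_p^\times/(\mathbb{Z}_p^\times)^2$. For a rational relation $\theta$, set $v_p(C_\theta(M))=\frac1n v_p(C_{n\theta}(M))$ for any integer $n\ge1$ such that $n\theta$ is integral. Artin relation: there are unique $\alpha_H\in\mathbb{Q}$, for $H$ running over representatives of conjugacy classes of cyclic subgroups of $G$, such that $[\mathbf 1]=\sum_H\alpha_H[\mathbb{Q}[G/H]]$ in $A(\mathbb{Q}[G])$. The Artin relation is $\theta_G=[G]-\sum_H\alpha_H[H]\in\mathrm{BR}_0(G)$. For $H\le G$, $\theta_H$ is regarded as an element of $\mathrm{BR}_0(G)$ by induction. Permutation pairing: $P(G)$ is the free $\mathbb{Q}$-vector space on conjugacy classes of non-cyclic $p$-hypo-elementary subgroups of $G$, and $\langle H,K\rangle_{\mathrm{perm}}=v_p(C_{\theta_H}(\mathbb{Z}_p[G/K]))$.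 *)

(* Defs.v *)
From HB Require Import structures.
From mathcomp Require Import all_boot all_order all_algebra all_fingroup all_solvable all_field all_character.
Set Implicit Arguments. Unset Strict Implicit. Unset Printing Implicit Defensive.
Import Order.TTheory GRing.Theory Num.Theory.
Local Open Scope ring_scope.

Section Defs.
Variable gT : finGroupType.

Definition p_hypo_elementary (p : nat) (H : {group gT}) : Prop :=
  exists P : {group gT}, [/\ P \in 'Syl_p(H), P <| H & cyclic (H / P)]%g.

(* The H-orbits on the G-set G/K (left cosets gK, H acting by left
   multiplication).  The orbit sums form a basis of the fixed sublattice
   (R[G/K])^H. *)
Definition H_orbits (G H K : {set gT}) : {set {set {set gT}}} :=
  [set [set (h *: X)%g | h in H] | X in lcosets K G].

(* Gram matrix of (1/|H|) <,> restricted to (R[G/K])^H, w.r.t. the basis of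
   orbit sums, where <,> is the standard G-invariant form on R[G/K]
   (cosets orthonormal): <sum_{X in O} X, sum_{Y in O'} Y> = #|O :&: O'|. *)
Definition fixed_gram (G H K : {set gT}) : 'M[rat]_#|H_orbits G H K| :=
  \matrix_(i, j)
    ((#|(@enum_val _ (mem (H_orbits G H K)) i :&: @enum_val _ (mem (H_orbits G H K)) j)%SET|%:R : rat)
       / (#|H|%:R)).

Definition fixed_det (G H K : {set gT}) : rat := \det (fixed_gram G H K).

End Defs.

Definition vp (p : nat) (q : rat) : rat :=
  ((logn p `|numq q|%N)%:R - (logn p `|denq q|%N)%:R).

Definition cyclic_class_reps (gT : finGroupType) (H : {group gT})
    (R : {set {group gT}}) : Prop :=
  (forall C : {group gT}, C \in R -> C \subset H /\ cyclic C) /\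
  (forall C : {group gT}, C \subset H -> cyclic C ->
     exists2 D : {group gT}, D \in R & exists2 h, h \in H & (C : {set gT}) = (D :^ h)%g) /\
  (forall C D : {group gT}, C \in R -> D \in R ->
     forall h, h \in H -> (C : {set gT}) = (D :^ h)%g -> C = D).

(* alpha gives the coefficients of the Artin relation of H with respect to
   the representatives R:  [1] = sum_{C in R} alpha_C [Q[H/C]]  in A(Q[H]),
   expressed through characters ('Ind[H, C] 1 is the character of Q[H/C]). *)
Definition artin_coeffs (gT : finGroupType) (H : {group gT})
    (R : {set {group gT}}) (alpha : {group gT} -> rat) : Prop :=
  (1 : 'CF(H)) = \sum_(C in R) (ratr (alpha C) : algC) *: 'Ind[H, C] (1 : 'CF(C)).

(* v_p(C_{theta_H}(Z_p[G/K])) where theta_H = [H] - sum_{C in R} alpha_C [C]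
   (regulator constants are multiplicative in theta, so their valuation is
   linear in the coefficients). *)
Definition vp_reg_artin (p : nat) (gT : finGroupType) (G H : {group gT})
    (R : {set {group gT}}) (alpha : {group gT} -> rat) (K : {group gT}) : rat :=
  vp p (fixed_det G H K) - \sum_(C in R) alpha C * vp p (fixed_det G C K).

(* Main.v *)
(** Orbit sums turn the regulator constant into stabiliser orders:
    [v_p (C_[H] (Z_p[G/K]))] is minus the sum of [v_p |H :&: gKg^-1|] over the
    double cosets [HgK].  If H has a cyclic normal Sylow subgroup P, then
    [v_p |L|] counts the nontrivial subgroups Q of P contained in L <= H, so the
    sum becomes [|H|^-1 \sum_Q \sum_(h in H) m(<h>Q, K)], where [m(L, K)] is the
    number of fixed points of L on G/K.  The same holds for cyclic C <= H with
    Q <= C and h in C, and evaluating the Artin identity at a generator of <h>Q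
    shows that the relation removes exactly the terms with <h>Q cyclic.
    The matrix is thus the product of the matrix counting the pairs (Q, h) with
    <h>Q conjugate to a given group, and of the table of marks of the non-cyclic
    p-hypo-elementary subgroups; both are triangular for the order of the
    subgroups, with nonzero diagonal. *)

Require Import Defs.
From HB Require Import structures.
From mathcomp Require Import all_boot all_order all_algebra all_fingroup all_solvable all_field all_character.
From mathcomp Require Import ring.
Set Implicit Arguments. Unset Strict Implicit. Unset Printing Implicit Defensive.
Import Order.TTheory GRing.Theory Num.Theory.
Local Open Scope ring_scope.

(** * Valuations of reciprocals and of finite products *)

Lemma vp_natV (p n : nat) : (0 < n)%N -> vp p (n%:R^-1 : rat) = - (logn p n)%:R.
Proof.
move=> n_gt0; have n1: coprime `|1%:Z| `|n%:Z| by rewrite coprime1n.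
have n0: n%:Z != 0 by rewrite eqz_nat -lt0n.
have := coprimeq_den n1; have := coprimeq_num n1.
rewrite (negPf n0) mul1r /vp -[n%:R^-1]/((n%:Z%:~R)^-1 : rat) => -> ->.
by rewrite mulr1 gtr0_sg ?ltz_nat // logn1 sub0r.
Qed.

Lemma logn_prod (I : finType) (A : {pred I}) (F : I -> nat) (p : nat) :
  (forall i, i \in A -> 0 < F i)%N ->
  logn p (\prod_(i in A) F i) = (\sum_(i in A) logn p (F i))%N.
Proof.
move=> F_gt0; suff [] : ((0 < \prod_(i in A) F i)%N /\
  logn p (\prod_(i in A) F i) = (\sum_(i in A) logn p (F i))%N) by [].
apply: (big_rec2 (fun a b => (0 < a)%N /\ logn p a = b)); first by rewrite logn1.
move=> i a _ Ai [a_gt0 <-]; have Fi := F_gt0 i Ai.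
by rewrite muln_gt0 Fi lognM.
Qed.

(** * Determinants on fixed sublattices through orbits and stabilisers *)

Section FixedDet.
Variable gT : finGroupType.
Implicit Types (G H K : {group gT}) (g h : gT) (X : {set gT}).

(** Distinct orbits are disjoint, so the Gram matrix is diagonal. *)
Lemma fixed_det_prod (G H K : {set gT}) :
  trivIset (H_orbits G H K) ->
  fixed_det G H K = \prod_(O in H_orbits G H K) (#|O|%:R / #|H|%:R).
Proof.
move=> tI; pose d := \row_i (#|@enum_val _ (mem (H_orbits G H K)) i|%:R / #|H|%:R : rat).
rewrite /fixed_det; have ->: fixed_gram G H K = diag_mx d.
  apply/matrixP=> i j; rewrite !mxE; case: eqVneq => [->|ne_ij].
    by rewrite setIid mulr1n.
  have /trivIsetP/(_ _ _ (enum_valP i) (enum_valP j)) := tI.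
  rewrite (inj_eq enum_val_inj) => /(_ ne_ij).
  by rewrite -setI_eq0 => /eqP->; rewrite cards0 mul0r mulr0n.
rewrite det_diag [RHS](@big_enum_val _ _ _ _ (mem (H_orbits G H K))).
by apply: eq_bigr => i _; rewrite mxE.
Qed.

(* Inverting g turns left multiplication into a right action, as required by
   [action]. *)
Definition ltrans X g : {set gT} := (g^-1 *: X)%g.

Lemma ltrans1 : ltrans^~ 1%g =1 id.
Proof. by move=> X; rewrite /ltrans invg1 lcoset1. Qed.

Lemma ltransM X : act_morph ltrans X.
Proof. by move=> g h; rewrite /ltrans invMg lcosetM. Qed.

Canonical ltrans_action := TotalAction ltrans1 ltransM.

Lemma H_orbitsE G H K :
  H_orbits G H K = [set orbit ltrans_action H X | X in lcosets K G].
Proof.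
apply: eq_imset => X; apply/setP=> Y; apply/imsetP/imsetP => -[h Hh ->];
  exists h^-1%g; rewrite ?groupV //=.
- by rewrite /ltrans invgK.
Qed.

Lemma H_orbits_partition G H K :
  H \subset G -> partition (H_orbits G H K) (lcosets K G).
Proof.
move=> sHG; rewrite H_orbitsE; apply: orbit_partition.
apply/subsetP=> h Hh; rewrite !inE /=; apply/subsetP=> _ /lcosetsP[g Gg ->].
rewrite inE /= /ltrans -lcosetM; apply/lcosetsP.
by exists (h^-1 * g)%g; rewrite // groupM ?groupV // (subsetP sHG).
Qed.

Lemma astab1_ltrans H K g :
  ('C_H[(g *: K)%g | ltrans_action] = H :&: K :^ g^-1)%g.
Proof.
apply/setP=> h; rewrite !inE sub1set inE /=; congr (_ && _).
rewrite mem_conjg invgK; apply/eqP/idP => [gK | Kgh].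
  have := lcoset_refl K g; rewrite -{1}gK /ltrans -lcosetM mem_lcoset.
  by rewrite invMg invgK conjgE mulgA.
rewrite /ltrans -lcosetM; apply/lcoset_eqP.
by rewrite mem_lcoset -groupV !invMg !invgK -mulgA -conjgE.
Qed.

Lemma sum_lcosets G K (F : {set gT} -> rat) : K \subset G ->
  \sum_(X in lcosets K G) F X = #|K|%:R^-1 * \sum_(g in G) F (g *: K)%g.
Proof.
move=> sKG; rewrite (partition_big_imset (lcoset K)) mulr_sumr.
apply: eq_bigr => _ /lcosetsP[g Gg ->].
rewrite (eq_bigr (fun _ => F (g *: K)%g)) => [|x /andP[_ /eqP <-]]; last first.
  by rewrite lcosetE.
rewrite (eq_bigl [in (g *: K)%g]) => [|x].
  by rewrite sumr_const card_lcoset -[F _ *+ _]mulr_natl mulKf // pnatr_eq0 -lt0n.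
rewrite lcosetE; apply/andP/idP => [[_ /eqP <-]|gKx]; first by rewrite lcoset_refl.
split; last exact/eqP/lcoset_eqP.
by case/lcosetP: gKx => k Kk ->; rewrite groupM // (subsetP sKG).
Qed.

(** By orbit-stabiliser an orbit contributes the inverse of its stabiliser order. Averaging over the
    points of the orbit, then over the elements of each coset, turns the sum over orbits into one
    over [G]. *)
Lemma vp_fixed_det p G H K : H \subset G -> K \subset G ->
  vp p (fixed_det G H K) =
    - (#|H|%:R^-1 * #|K|%:R^-1 *
       \sum_(g in G) (#|H :&: K :^ g|%g * logn p #|H :&: K :^ g|%g)%N%:R).
Proof.
move=> sHG sKG; have partO := H_orbits_partition K sHG.
have tI : trivIset (H_orbits G H K) by case/and3P: partO.
pose st X := #|('C_H[X | ltrans_action])%g|.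
(* The stabiliser order is read off from [#|O|], which avoids choosing a point of the orbit. *)
pose s (O : {set {set gT}}) := (#|H| %/ #|O|)%N.
have oO O X : O \in H_orbits G H K -> X \in O -> (#|O| * st X)%N = #|H|.
  rewrite H_orbitsE => /imsetP[Y _ ->] /orbit_eqP <-.
  by rewrite card_orbit_stab.
have sO O X : O \in H_orbits G H K -> X \in O -> s O = st X.
  move=> OO XO; rewrite /s -(oO O X) // mulKn //.
  by rewrite card_gt0; apply/set0Pn; exists X.
have neO O : O \in H_orbits G H K -> exists X, X \in O.
  by move=> OO; apply/set0Pn; case/and3P: partO => _ _; apply: contraNneq => <-.
rewrite fixed_det_prod //.
rewrite (eq_bigr (fun O => (s O)%:R^-1)) => [|O OO]; last first.
  have [X XO] := neO O OO; rewrite (sO O X) // -(oO O X) // natrM invfM mulrA divff ?mul1r //.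
  by rewrite pnatr_eq0 -lt0n card_gt0; apply/set0Pn; exists X.
rewrite prodfV -natr_prod vp_natV; last first.
  apply: prodn_cond_gt0 => O OO; have [X XO] := neO O OO.
  by rewrite (sO O X) // cardG_gt0.
rewrite logn_prod => [|O OO]; last first.
  by have [X XO] := neO O OO; rewrite (sO O X) // cardG_gt0.
congr (- _); rewrite natr_sum.
(* The term of an orbit is spread evenly over its points, with [1 / #|O|] equal to [st X / #|H|]. *)
transitivity (\sum_(X in lcosets K G) #|H|%:R^-1 * (st X * logn p (st X))%N%:R : rat).
  rewrite (set_partition_big _ partO) /=; apply: eq_bigr => O OO.
  have [X XO] := neO O OO.
  rewrite (eq_bigr (fun _ => #|H|%:R^-1 * (st X * logn p (s O))%N%:R)) => [|Y YO].
    rewrite sumr_const -[RHS]mulr_natl mulrCA -natrM mulnA (oO O X) // natrM mulKf //.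
    by rewrite pnatr_eq0 -lt0n.
  by rewrite -(sO O X) // (sO O Y).
rewrite -mulr_sumr sum_lcosets // mulrA; congr (_ * _).
rewrite [RHS](reindex_inj invg_inj) /=; apply: eq_big => g; first by rewrite groupV.
by rewrite /st astab1_ltrans.
Qed.
End FixedDet.

(** * Subgroups of a cyclic Sylow subgroup, and marks *)

Section Marks.
Local Open Scope group_scope.
Local Open Scope ring_scope.
Variables (gT : finGroupType) (p : nat).
Hypothesis p_pr : prime p.
Implicit Types (G H K L P Q C : {group gT}) (g h : gT).

Definition nontrivial_subgroups P := [set Q : {group gT} | Q \subset P & Q :!=: 1%g].

(** A cyclic group of order [p ^ v] has exactly one subgroup of order [p ^ i.+1] for each [i < v],
    and these are all the nontrivial ones. *)
Lemma card_nontrivial_subgroups P :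
  cyclic P -> (p.-group P)%g -> #|nontrivial_subgroups P| = logn p #|P|.
Proof.
move=> cycP pP; have [a defP] := cyclicP cycP; have oP := card_pgroup pP.
set v := logn p #|P| in oP *.
have oQ i : (i < v)%N -> #|<[a ^+ (p ^ (v - i.+1))]>%g| = (p ^ i.+1)%N.
  move=> lt_iv; have oa : #[a]%g = (p ^ v)%N by rewrite orderE -defP.
  rewrite -orderE orderXdiv oa; last by rewrite dvdn_exp2l ?leq_subr.
  by rewrite -expnB ?prime_gt0 ?leq_subr // subKn.
pose f (i : 'I_v) := <[a ^+ (p ^ (v - i.+1))]>%G.
have f_inj : injective f.
  move=> i j /(congr1 (fun Q : {group gT} => #|Q|)) /=.
  rewrite !oQ // => /eqP; rewrite eqn_exp2l ?prime_gt1 // => /eqP[] ?.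
  exact: val_inj.
rewrite -[RHS]card_ord -(card_imset _ f_inj); apply: eq_card => Q.
apply/idP/imsetP => [|[i _ ->]]; last first.
  rewrite inE /= {1}defP cycleX -cardG_gt1 oQ //.
  by rewrite -(expn0 p) ltn_exp2l ?prime_gt1.
rewrite inE => /andP[sQP ntQ]; have oQp := card_pgroup (pgroupS sQP pP).
have v_gt0 : (0 < logn p #|Q|)%N.
  by rewrite lt0n; apply: contraNneq ntQ => v0; rewrite trivg_card1 oQp v0.
have le_v : (logn p #|Q| <= v)%N by apply: dvdn_leq_log; rewrite ?cardSg.
have lt_v : ((logn p #|Q|).-1 < v)%N by rewrite prednK.
exists (Ordinal lt_v) => //; apply/eqP.
rewrite -val_eqE /= (eq_subG_cyclic cycP) ?oQ ?prednK //; first exact/eqP.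
by rewrite [in X in _ \subset X]defP cycleX.
Qed.

(** The intersection [P :&: L] is a cyclic Sylow subgroup of [L], whose nontrivial subgroups are
    those of [P] lying in [L]. *)
Lemma logn_card_nontrivial_subgroups H P L :
    P \in 'Syl_p(H)%g -> (P <| H)%g -> cyclic P -> L \subset H ->
  logn p #|L| = #|[set Q in nontrivial_subgroups P | Q \subset L]|.
Proof.
rewrite inE => sylP nPH cycP sLH.
have sylPL : (p.-Sylow(L) (P :&: L))%g by exact: setI_normal_Hall nPH sylP sLH.
rewrite -logn_part -(card_Hall sylPL) -card_nontrivial_subgroups; first last.
- exact: pHall_pgroup sylPL.
- exact: cyclicS (subsetIl _ _) cycP.
by apply: eq_card => Q; rewrite !inE subsetI -!andbA; do !bool_congr.
Qed.

(* The number of fixed points of L on G/K. *)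
Definition mark G L K : rat :=
  #|K|%:R^-1 * #|[set g in G | L \subset (K :^ g)%g]|%:R.

Lemma mark_conj G K L g : g \in G -> mark G (L :^ g)%G K = mark G L K.
Proof.
move=> Gg; rewrite /mark; congr (_ * _%:R).
rewrite -(card_rcoset [set x in G | L \subset (K :^ x)%g] g).
apply: eq_card => x; rewrite mem_rcoset !inE groupMr ?groupV //.
by rewrite conjsgM -sub_conjg.
Qed.

(** For [L = C :&: K :^ g], the weight [#|L| * logn p #|L|] counts the pairs [(c, Q)] in [C] with
    [<[c]> <*> Q] inside [K :^ g]. Summing over [g] first yields marks. *)
Lemma vp_fixed_det_marks G H P C K :
    P \in 'Syl_p(H)%g -> (P <| H)%g -> cyclic P ->
    C \subset H -> H \subset G -> K \subset G ->
  vp p (fixed_det G C K) =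
    - (#|C|%:R^-1 * \sum_(Q in nontrivial_subgroups P | Q \subset C)
                      \sum_(c in C) mark G (<[c]> <*> Q) K).
Proof.
move=> sylP nPH cycP sCH sHG sKG.
rewrite vp_fixed_det // ?(subset_trans sCH) // -mulrA; congr (- (_ * _)).
under [RHS]eq_bigr do rewrite -mulr_sumr.
rewrite -mulr_sumr; congr (_ * _).
under [RHS]eq_bigr do under eq_bigr do rewrite -sum1_card natr_sum big_mkcond /=.
under [RHS]eq_bigr do rewrite exchange_big /=.
rewrite exchange_big /= [LHS]big_mkcond /=; apply: eq_bigr => g _.
case: ifP => Gg; last first.
  by rewrite big1 // => Q _; rewrite big1 // => c _; rewrite inE Gg.
have sLH : C :&: K :^ g \subset H by rewrite subIset ?sCH.
rewrite (logn_card_nontrivial_subgroups sylP nPH cycP sLH) natrM.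
rewrite -sum1_card natr_sum mulr_sumr.
rewrite [LHS](eq_bigl (fun Q => (Q \in nontrivial_subgroups P) && (Q \subset C) &&
                           (Q \subset (K :^ g)%g))) => [|Q]; last first.
  by rewrite inE subsetI andbA.
rewrite [LHS]big_mkcondr /=; apply: eq_bigr => Q _; rewrite mulr1.
case: ifP => sQK; last first.
  rewrite big1 // => c _; rewrite inE Gg join_subG sQK andbF //.
rewrite -sum1_card natr_sum big_mkcond [RHS]big_mkcond /=; apply: eq_bigr => c _.
by rewrite !inE Gg join_subG cycle_subG sQK andbT; case: (c \in C).
Qed.
End Marks.

(** * The Artin identity and the resulting cancellation *)

Section Artin.
Variable gT : finGroupType.
Local Open Scope group_scope.
Local Open Scope ring_scope.
Implicit Types (G H K L P Q C : {group gT}) (g h : gT).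

Variables (H : {group gT}) (R : {set {group gT}}) (alpha : {group gT} -> rat).
Hypothesis sRH : forall C, C \in R -> C \subset H.
Hypothesis cycR : forall C, C \in R -> cyclic C.
Hypothesis artin : artin_coeffs H R alpha.

Lemma artin_coeffs_point h : h \in H ->
  \sum_(C in R) alpha C * (#|C|%:R^-1 * \sum_(y in H) (h ^ y \in C)%g%:R) = 1.
Proof.
move=> Hh; apply: (fmorph_inj (ratr : rat -> algC)).
have := congr1 (fun phi : 'CF(H) => phi h) artin.
rewrite cfun1E Hh sum_cfunE => e; rewrite rmorph1 [RHS]e rmorph_sum.
apply: eq_bigr => C RC; rewrite cfunE cfIndE ?sRH // !rmorphM fmorphV rmorph_nat rmorph_sum.
by congr (_ * (_ * _)); apply: eq_bigr => y _; rewrite cfun1E rmorph_nat.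
Qed.

(* If <h>Q is cyclic, a subgroup containing Q contains a conjugate of h iff it
   contains the corresponding conjugate of a generator of <h>Q, and a subgroup
   not containing Q contains no conjugate of that generator. *)
Lemma artin_coeffs_over Q h : (Q <| H)%g -> h \in H ->
  \sum_(C in R | Q \subset C)
    alpha C * (#|C|%:R^-1 * \sum_(y in H) (h ^ y \in C)%g%:R)
  = (cyclic (<[h]> <*> Q))%:R.
Proof.
move=> /andP[sQH nQH] Hh; have nQ y : y \in H -> Q :^ y = Q.
  by move=> Hy; apply: (normP (subsetP nQH y Hy)).
have [cyc|ncyc] := boolP (cyclic _); last first.
  apply: big1 => C /andP[RC sQC]; rewrite big1 ?mulr0 // => y Hy.
  apply/eqP; rewrite pnatr_eq0 eqb0; apply: contra ncyc => ChY.
  rewrite -(cyclicJ _ y) conjYg -cycleJ nQ //.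
  by apply: cyclicS (cycR RC); rewrite join_subG cycle_subG ChY.
have [d defD] := cyclicP cyc.
have Dd : forall C y, y \in H -> (d ^ y \in C)%g = (h ^ y \in C)%g && (Q \subset C).
  move=> C y Hy.
  by rewrite -cycle_subG cycleJ -defD conjYg -cycleJ nQ // join_subG cycle_subG.
have Hd : d \in H.
  by rewrite -cycle_subG -defD join_subG cycle_subG Hh.
rewrite -[RHS](artin_coeffs_point Hd) big_mkcondr /=; apply: eq_bigr => C RC.
case: ifP => sQC; last first.
  by rewrite big1 ?mulr0 // => y Hy; rewrite Dd // sQC andbF.
by congr (_ * (_ * _)); apply: eq_bigr => y Hy; rewrite Dd // sQC andbT.
Qed.

(** Since [F] is invariant under conjugation by [H], every [y] contributes the same sum over [C].
    This brings sums over [C] to the shape in which [artin_coeffs_over] applies. *)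
Lemma sum_class_subgroup C (F : gT -> rat) : C \subset H ->
    (forall h y, h \in H -> y \in H -> F (h ^ y)%g = F h) ->
  \sum_(c in C) F c =
    #|H|%:R^-1 * \sum_(h in H) F h * \sum_(y in H) (h ^ y \in C)%g%:R.
Proof.
move=> sCH FJ.
under [in RHS]eq_bigr do rewrite mulr_sumr.
rewrite exchange_big /= [in RHS](eq_bigr (fun _ => \sum_(c in C) F c)) => [|y Hy].
  by rewrite sumr_const -[X in _ * X]mulr_natl mulKf // pnatr_eq0 -lt0n.
transitivity (\sum_(h in H) F (h ^ y)%g * (h ^ y \in C)%g%:R).
  by apply: eq_bigr => h Hh; rewrite FJ.
rewrite [LHS](reindex_inj (conjg_inj y^-1%g)) [LHS]big_mkcond [RHS]big_mkcond /=.
apply: eq_bigr => h _; rewrite conjgKV groupJr ?groupV //.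
case: (boolP (h \in C)) => [Ch|_]; first by rewrite (subsetP sCH) ?mulr1.
by rewrite mulr0 if_same.
Qed.

Variables (G P K : {group gT}) (p : nat).
Hypotheses (p_pr : prime p) (sylP : P \in 'Syl_p(H)%g) (nPH : (P <| H)%g).
Hypotheses (cycP : cyclic P) (sHG : H \subset G) (sKG : K \subset G).

Lemma vp_reg_artin_marks :
  vp_reg_artin p G H R alpha K =
    - (#|H|%:R^-1 * \sum_(Q in nontrivial_subgroups P)
         \sum_(h in H | ~~ cyclic (<[h]> <*> Q)) mark G (<[h]> <*> Q) K).
Proof.
have nQH Q : Q \in nontrivial_subgroups P -> (Q <| H)%g.
  rewrite inE => /andP[sQP _]; apply: char_normal_trans nPH.
  by rewrite sub_cyclic_char.
pose F Q h := mark G (<[h]> <*> Q)%G K.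
have FJ Q : Q \in nontrivial_subgroups P ->
    forall h y, h \in H -> y \in H -> F Q (h ^ y)%g = F Q h.
  move=> SQ h y Hh Hy; rewrite /F -(mark_conj K (<[h]> <*> Q)%G (subsetP sHG y Hy)).
  congr (mark _ _ _); apply: val_inj => /=.
  have /andP[_ /subsetP/(_ y Hy)/normP nQ] := nQH Q SQ.
  by rewrite conjYg -cycleJ nQ.
rewrite /vp_reg_artin (vp_fixed_det_marks p_pr sylP nPH) //.
(* For fixed [Q] and [h], the sum over the [C] containing [Q] is the one evaluated by
   [artin_coeffs_over]. *)
have -> : \sum_(C in R) alpha C * vp p (fixed_det G C K) =
    - (#|H|%:R^-1 * \sum_(Q in nontrivial_subgroups P)
         \sum_(h in H) F Q h * (cyclic (<[h]> <*> Q))%:R).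
  under eq_bigr => C RC.
    rewrite (vp_fixed_det_marks p_pr sylP nPH) ?sRH // mulrN.
    over.
  rewrite sumrN; congr (- _).
  under eq_bigr => C RC do rewrite big_mkcondr !mulr_sumr /=.
  rewrite exchange_big /= mulr_sumr; apply: eq_bigr => Q SQ.
  transitivity (\sum_(C in R | Q \subset C) alpha C * (#|C|%:R^-1 *
     (#|H|%:R^-1 * \sum_(h in H) F Q h * \sum_(y in H) (h ^ y \in C)%g%:R))).
    rewrite [RHS]big_mkcondr /=; apply: eq_bigr => C RC; case: ifP => _.
      by rewrite -(sum_class_subgroup (sRH RC) (FJ Q SQ)).
    by rewrite !mulr0.
  under [in RHS]eq_bigr => h Hh do rewrite -(artin_coeffs_over (nQH Q SQ) Hh) mulr_sumr.
  rewrite exchange_big mulr_sumr; apply: eq_bigr => C _.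
  rewrite !mulr_sumr; apply: eq_bigr => h _.
  by ring.
rewrite opprK addrC -opprB -mulrBr; congr (- (_ * _)).
rewrite [X in X - _](eq_bigl [in nontrivial_subgroups P]) => [|Q]; last first.
  by apply: andb_idr => SQ; case/andP: (nQH Q SQ).
rewrite -sumrB; apply: eq_bigr => Q _.
rewrite -sumrB [RHS]big_mkcondr /=; apply: eq_bigr => h _.
by rewrite -/(F Q h); case: (cyclic _); rewrite /= ?mulr1 ?mulr0 ?subrr ?subr0.
Qed.
End Artin.

(** * Invertibility of triangular matrices *)

(** In the support of a nonzero left kernel vector [v], choose [i] with [s i] minimal: column [i]
    then reduces to [v 0 i * B i i], which is nonzero. *)
Lemma triangular_unitmx (F : fieldType) (m : nat) (B : 'M[F]_m) (s : 'I_m -> nat) :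
    (forall i, B i i != 0) ->
    (forall i j, B i j != 0 -> i != j -> (s i < s j)%N) ->
  B \in unitmx.
Proof.
move=> Bdiag Btri; rewrite -row_free_unit -kermx_eq0.
apply/negPn/negP => /rowV0Pn[v /sub_kermxP vB0 nz_v].
have /existsP[i0 vi0] : [exists i, v 0 i != 0].
  apply: contraNT nz_v => /existsPn v0; apply/eqP/rowP => i.
  by rewrite mxE; apply/eqP/negPn/v0.
have [i vi min_i] := @arg_minnP _ i0 (fun i => v 0 i != 0) s vi0.
have /rowP/(_ i) := vB0; rewrite !mxE (bigD1 i) //= big1 ?addr0 => [|j ne_ji].
  by move/eqP; rewrite mulf_eq0 (negPf vi) (negPf (Bdiag i)).
apply/eqP; apply: contraT; rewrite mulf_eq0 negb_or => /andP[vj Bji].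
by have := Btri _ _ Bji ne_ji; rewrite ltnNge min_i.
Qed.

(** * Subgroups and generation of hypo-elementary groups *)

Section HypoElementary.
Variables (gT : finGroupType) (p : nat).
Local Open Scope group_scope.
Implicit Types (G H K L P Q C : {group gT}) (g h : gT).

(** The subgroup [P :&: L] serves for [L]: by the second isomorphism theorem its quotient embeds in
    [H / P]. *)
Lemma p_hypo_elementaryS H L :
  L \subset H -> p_hypo_elementary p H -> p_hypo_elementary p L.
Proof.
move=> sLH [P []]; rewrite inE => sylP nPH cycHP.
have nPL := subset_trans sLH (normal_norm nPH).
exists (P :&: L)%G; split.
- by rewrite inE; apply: setI_normal_Hall nPH sylP sLH.
- by rewrite /= setIC; apply: normalGI sLH nPH.
- rewrite /= (isog_cyclic (second_isog nPL)).
  by apply: cyclicS cycHP; apply: quotientS.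
Qed.

Lemma join_cycle_cyclic_quotient H P :
  P <| H -> cyclic (H / P) -> exists2 h, h \in H & <[h]> <*> P = H.
Proof.
move=> nPH /cyclicP[z defHP].
have : z \in H / P by rewrite defHP cycle_id.
case/morphimP=> h Nh Hh def_z; exists h => //.
have sLH : <[h]> <*> P \subset H by rewrite join_subG cycle_subG Hh normal_sub.
apply: (quotient_inj (H := P)) => //.
  by apply: normalS nPH; rewrite ?joing_subr.
by rewrite quotientYidr ?cycle_subG // quotient_cycle // defHP def_z.
Qed.
End HypoElementary.

(** * Factorisation of the pairing matrix *)

Unset Implicit Arguments.

Theorem theorem1p1 (gT : finGroupType) (G : {group gT}) (p : nat)
  (p_prime : prime p)
  (sylow_cyclic : forall P : {group gT}, (P \in 'Syl_p(G))%g -> cyclic P)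
  (m : nat) (Hs : 'I_m -> {group gT})
  (Hs_sub : forall a, Hs a \subset G)
  (Hs_phe : forall a, p_hypo_elementary p (Hs a))
  (Hs_noncyc : forall a, ~~ cyclic (Hs a))
  (Hs_cover : forall K : {group gT}, K \subset G -> p_hypo_elementary p K ->
      ~~ cyclic K -> exists a, exists2 g, g \in G & (K : {set gT}) = (Hs a :^ g)%g)
  (Hs_distinct : forall a b g, g \in G -> (Hs a : {set gT}) = (Hs b :^ g)%g -> a = b)
  (Rs : 'I_m -> {set {group gT}}) (alpha : 'I_m -> {group gT} -> rat)
  (Rs_reps : forall a, cyclic_class_reps (Hs a) (Rs a))
  (alpha_artin : forall a, artin_coeffs (Hs a) (Rs a) (alpha a)) :
  (\matrix_(a < m, b < m) vp_reg_artin p G (Hs a) (Rs a) (alpha a) (Hs b))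
    \in unitmx.
Proof.
have [P PP] := fin_all_exists Hs_phe.
have sylP a : P a \in 'Syl_p(Hs a)%g by case: (PP a).
have nPH a : (P a <| Hs a)%g by case: (PP a).
have cycP a : cyclic (P a).
  have := sylP a; rewrite inE => /pHall_pgroup pP.
  have sPG := subset_trans (normal_sub (nPH a)) (Hs_sub a).
  have [S sylS sPS] := Sylow_superset sPG pP.
  by apply: cyclicS sPS _; apply: sylow_cyclic; rewrite inE.
pose cls (L : {group gT}) c := (L : {set gT}) \in (Hs c :^: G)%g.
have clsP (L : {group gT}) c : cls L c -> exists2 g, g \in G & (L : {set gT}) = (Hs c :^ g)%g.
  by case/imsetP=> g; exists g.
have card_cls L c : cls L c -> #|L| = #|Hs c|.
  by case/clsP=> g _ ->; rewrite cardJg.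
pose N a c := (\sum_(Q in nontrivial_subgroups (P a))
  \sum_(h in Hs a | ~~ cyclic (<[h]> <*> Q)%g) cls (<[h]> <*> Q)%G c)%N.
pose A := \matrix_(a, c) (- (#|Hs a|%:R^-1 * (N a c)%:R)) : 'M[rat]_m.
pose M := \matrix_(a, b) mark G (Hs a) (Hs b) : 'M[rat]_m.
have subY a Q h : Q \in nontrivial_subgroups (P a) -> h \in Hs a ->
    (<[h]> <*> Q \subset Hs a)%g.
  rewrite inE => /andP[sQP _] Hh; rewrite join_subG cycle_subG Hh.
  exact: subset_trans sQP (normal_sub (nPH a)).
have A_unit : A \in unitmx.
  (* A nonzero entry [A a c] gives a conjugate of [Hs c] inside [Hs a], so orders grow towards the
     row index; transposing fits [triangular_unitmx]. *)
  rewrite -unitmx_tr; apply: (triangular_unitmx (s := fun a => #|Hs a|)).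
    move=> a; rewrite !mxE oppr_eq0 mulf_neq0 ?invr_eq0 ?pnatr_eq0 -?lt0n //.
    (* The pair [(P a, h)], with [h] lifting a generator of the cyclic quotient, generates [Hs a]
       and makes the diagonal count positive. *)
    have [h Hh defH] : exists2 h, h \in Hs a & (<[h]> <*> P a)%g = Hs a.
      by case: (PP a) => _ _; apply: join_cycle_cyclic_quotient.
    have ntP : P a \in nontrivial_subgroups (P a).
      rewrite inE subxx /=; apply: contraNneq (Hs_noncyc a) => P1.
      by rewrite -defH P1 joingG1 cycle_cyclic.
    rewrite /N (bigD1 (P a)) //= (bigD1 h) /=; last by rewrite Hh defH Hs_noncyc.
    rewrite (_ : cls _ _ = true) //; apply/imsetP; exists 1%g => //=.
    by rewrite conjsg1.
  move=> c a; rewrite !mxE oppr_eq0 mulf_eq0 negb_or pnatr_eq0 => /andP[_].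
  rewrite sum_nat_eq0 negb_forall => /existsP[Q]; rewrite negb_imply => /andP[SQ].
  rewrite sum_nat_eq0 negb_forall => /existsP[h]; rewrite negb_imply.
  case/andP=> /andP[Hh _]; rewrite eqb0 negbK => /= clsL ne_ca.
  rewrite -(card_cls _ _ clsL) ltn_neqAle subset_leq_card ?subY // andbT.
  apply: contra ne_ca => /eqP eq_card.
  have [g Gg defL] := clsP _ _ clsL.
  apply/eqP/esym/(Hs_distinct _ _ g Gg); rewrite -defL.
  by apply/esym/eqP; rewrite eqEcard subY //; apply: eq_leq (esym eq_card).
have M_unit : M \in unitmx.
  (* A nonzero mark puts [Hs a] inside a conjugate of [Hs b]; equal orders would make the two
     conjugate, hence [a = b]. *)
  apply: (triangular_unitmx (s := fun a => #|Hs a|)) => [a|a b].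
    rewrite mxE mulf_neq0 ?invr_eq0 ?pnatr_eq0 -?lt0n //.
    by apply/card_gt0P; exists 1%g; rewrite inE group1 conjsg1 /=.
  rewrite mxE mulf_eq0 negb_or pnatr_eq0 => /andP[_]; rewrite -lt0n.
  case/card_gt0P=> g; rewrite inE => /andP[Gg sab] ne_ab.
  rewrite -(cardJg (Hs b) g) ltn_neqAle subset_leq_card // andbT.
  apply: contra ne_ab => /eqP eq_card; apply/eqP/(Hs_distinct _ _ g Gg)/eqP.
  by rewrite eqEcard sab eq_card /=.
suff -> : \matrix_(a, b) vp_reg_artin p G (Hs a) (Rs a) (alpha a) (Hs b) = A *m M.
  by rewrite unitmx_mul A_unit.
apply/matrixP=> a b; rewrite !mxE.
have [Rs_cyc _] := Rs_reps a.
rewrite (@vp_reg_artin_marks _ _ _ _ _ _ (alpha_artin a) _ (P a)) //; first last.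
- by move=> C /Rs_cyc[].
- by move=> C /Rs_cyc[].
under [RHS]eq_bigr do rewrite !mxE mulNr -mulrA.
rewrite sumrN -mulr_sumr; congr (- (_ * _)).
under [RHS]eq_bigr do rewrite natr_sum mulr_suml.
rewrite exchange_big /=; apply: eq_bigr => Q SQ.
under [RHS]eq_bigr do rewrite natr_sum mulr_suml.
rewrite exchange_big /=; apply: eq_bigr => h /andP[Hh ncyc].
have sLH := subY a Q h SQ Hh.
(* The non-cyclic group [<[h]> <*> Q] inherits hypo-elementarity from [Hs a], so it is conjugate to
   exactly one [Hs c] and the sum over classes collapses to one mark. *)
have [c [g Gg defL]] := Hs_cover (<[h]> <*> Q)%G (subset_trans sLH (Hs_sub a))
  (p_hypo_elementaryS sLH (Hs_phe a)) ncyc.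
have clsc : cls (<[h]> <*> Q)%G c by apply/imsetP; exists g.
rewrite (bigD1 c) //= clsc mul1r big1 ?addr0 => [|d ne_dc].
  rewrite -(mark_conj _ (Hs c) Gg); congr (mark _ _ _).
  exact: val_inj.
case: (boolP (cls _ _)) => [/clsP[x Gx]|]; last by rewrite mul0r.
rewrite defL => /(congr1 (fun A => A :^ g^-1)%g).
rewrite conjsgK -conjsgM => /Hs_distinct eq_cd.
by rewrite eq_cd ?eqxx ?groupM ?groupV // in ne_dc.
Qed.
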